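(* Let $\mathbb{K}=\mathbb{R}$ or $\mathbb{C}$, and let $A=\begin{pmatrix}0&0\\0&b\end{pmatrix}$, $B=\begin{pmatrix}0&0\\0&d\end{pmatrix}$ with $b,d\in\mathbb{K}$, $b,d\neq0$. Then any solution $X\in M_2(\mathbb{K})$ of the system $XAX=BXB$, $XBX=AXA$ has one of the forms $X=\begin{pmatrix}\alpha&0\\\beta&0\end{pmatrix}$, or $X=\begin{pmatrix}\alpha&\beta\\0&0\end{pmatrix}$, or $X=\begin{pmatrix}\alpha&0\\0&\frac{b^2}{d}\end{pmatrix}$ with $b^3=d^3$ in this last case, where $\alpha,\beta\in\mathbb{K}$. *)

(* Defs.v *)
From HB Require Import structures.
From mathcomp Require Import all_boot all_order all_algebra.
From mathcomp Require Import reals complex.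

Set Implicit Arguments.
Unset Strict Implicit.
Unset Printing Implicit Defensive.

Import GRing.Theory.
Local Open Scope ring_scope.

(* mx2 a b c d has first row (a, b) and second row (c, d). *)
Definition mx2 (K : fieldType) (a b c d : K) : 'M[K]_2 :=
  \matrix_(i < 2, j < 2) nth 0 (nth [::] [:: [:: a; b]; [:: c; d]] i) j.

(* Main.v *)
Require Import Defs.
From HB Require Import structures.
From mathcomp Require Import all_boot all_order all_algebra.
From mathcomp Require Import reals complex.

Set Implicit Arguments.
Unset Strict Implicit.
Unset Printing Implicit Defensive.

Import GRing.Theory.
Local Open Scope ring_scope.

(** Write [X] as [mx2 x y z w]. As [A] and [B] are supported on the last diagonal entry, [XAX = BXB]
    reduces to [ybz = ybw = wbz = 0] and [wbw = dwd], and [XBX = AXA] contributes [wdw = bwb].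
    Everything then hinges on [w]: if [w = 0], what remains is [yz = 0], which gives the first two
    forms; otherwise [y = z = 0], and cancelling [w] leaves [wb = d^2] and [wd = b^2]. *)

Lemma mx2_eta (K : fieldType) (X : 'M[K]_2) :
  X = mx2 (X 0 0) (X 0 1) (X 1 0) (X 1 1).
Proof.
apply/matrixP => i j; rewrite mxE.
by case: i j => [[|[|//]] ?] [[|[|//]] ?] /=; congr (X _ _); apply/val_inj.
Qed.

Lemma mulmx_mx2 (K : fieldType) (a b c d a' b' c' d' : K) :
  mx2 a b c d *m mx2 a' b' c' d' =
  mx2 (a * a' + b * c') (a * b' + b * d') (c * a' + d * c') (c * b' + d * d').
Proof.
apply/matrixP => i j; rewrite !mxE !big_ord_recl big_ord0 !mxE /= addr0.
by case: i j => [[|[|//]] ?] [[|[|//]] ?].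
Qed.

Lemma mx2_inj (K : fieldType) (a b c d a' b' c' d' : K) :
  mx2 a b c d = mx2 a' b' c' d' -> [/\ a = a', b = b', c = c' & d = d'].
Proof.
move=> /matrixP e.
by split; [have := e 0 0 | have := e 0 1 | have := e 1 0 | have := e 1 1];
  rewrite !mxE.
Qed.

Theorem proposition6p3 (R : realType) (K : fieldType)
    (hK : K = (R : fieldType) \/ K = (R[i] : fieldType))
    (b d : K) (hb : b != 0) (hd : d != 0) (A B X : 'M[K]_2)
    (hA : A = mx2 0 0 0 b) (hB : B = mx2 0 0 0 d)
    (hXAX : X *m A *m X = B *m X *m B) (hXBX : X *m B *m X = A *m X *m A) :
  (exists alpha beta : K, X = mx2 alpha 0 beta 0) \/
  (exists alpha beta : K, X = mx2 alpha beta 0 0) \/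
  (b ^+ 3 = d ^+ 3 /\ exists alpha : K, X = mx2 alpha 0 0 (b ^+ 2 / d)).
Proof.
move: hXAX hXBX; rewrite hA hB (mx2_eta X).
move: (X 0 0) (X 0 1) (X 1 0) (X 1 1) => x y z w.
rewrite !mulmx_mx2 !(mulr0, mul0r, addr0, add0r).
move=> /mx2_inj[/eqP yz0 /eqP yw0 /eqP wz0 bw2] /mx2_inj[_ _ _ dw2].
(* Since [b] is nonzero, each vanishing product becomes a disjunction between two entries of [X]. *)
move: yz0 yw0 wz0; rewrite !mulf_eq0 (negPf hb) !orbF.
have [-> yz0 _ _|w0 _] := eqVneq w 0.
  by case/orP: yz0 => /eqP->; [left | right; left]; exists x; eexists.
(* With [w] nonzero, [yw = 0] and [wz = 0] make [X] diagonal. *)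
rewrite orbF /= => /eqP-> /eqP->; right; right.
have bwE : w * b = d ^+ 2 by apply: (mulIf w0); rewrite bw2 mulrAC expr2.
have dwE : w * d = b ^+ 2 by apply: (mulIf w0); rewrite dw2 mulrAC expr2.
(* Both cubes equal [wbd]: [b^3 = (wd)b] and [d^3 = (wb)d]. *)
split; first by rewrite !(exprSr _ 2) -dwE -bwE mulrAC.
by exists x; rewrite -dwE mulfK.
Qed.
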